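(* Let $p>0$ and $k\in\{1,2,\dots\}$. Then $$U_k(p)=\sqrt{U_{k-1}(p)\,L_{k-1}(p)},\qquad L_k(p)=\sqrt{\frac{\frac p{p+1}}{U_{k-1}(p+1)\,L_{k-1}(p+1)}},$$ $$V_k(p)=\sqrt{p\,\frac{V_{k-1}(p)}{V_{k-1}(p+1)}},\qquad M_k(p)=\sqrt{p\,\frac{M_{k-1}(p)}{M_{k-1}(p+1)}},$$ where $V_k(p):=\sqrt p\,U_k(p)$ and $M_k(p):=\sqrt p\,L_k(p)$ for $k\in\{0,1,\dots\}$ and $p>0$. The initial conditions are $U_0(p)=1$, $L_0(p)=\sqrt{\frac p{p+1}}$, $V_0(p)=\sqrt p$, and $M_0(p)=\frac p{\sqrt{p+1}}$.
   Context: For $p\in(0,\infty)$, integers $m\ge0$, and $k\in\{0,1,\dots\}$, $$\sigma_{p,m}:=\sum_{j=0}^m(-1)^j\binom mj\ln(p+j),\qquad U_k(p):=\exp\sum_{m=1}^k2^{-1-m}\sigma_{p,m},\qquad L_k(p):=\sqrt{\frac p{p+1}}\,\frac1{U_k(p+1)},$$ where the sum of an empty family is $0$. *)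

(* Defs.v *)
From HB Require Import structures.
From mathcomp Require Import all_boot all_order all_algebra.
From mathcomp Require Import reals sequences exp.

Set Implicit Arguments.
Unset Strict Implicit.
Unset Printing Implicit Defensive.
Import Order.TTheory GRing.Theory Num.Theory.
Local Open Scope ring_scope.

(* All functions below are total in [p]; they are meant for [0 < p], where
   [ln] and [Num.sqrt] have their usual values. *)

Definition sigma (R : realType) (p : R) (m : nat) : R :=
  \sum_(0 <= j < m.+1) (-1) ^+ j * 'C(m, j)%:R * ln (p + j%:R).

Definition U (R : realType) (k : nat) (p : R) : R :=
  expR (\sum_(1 <= m < k.+1) 2 ^- (1 + m) * sigma p m).

Definition L (R : realType) (k : nat) (p : R) : R :=
  Num.sqrt (p / (p + 1)) * (1 / U k (p + 1)).

Definition V (R : realType) (k : nat) (p : R) : R := Num.sqrt p * U k p.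

Definition M (R : realType) (k : nat) (p : R) : R := Num.sqrt p * L k p.

(* Main.v *)
Require Import Defs.
From HB Require Import structures.
From mathcomp Require Import all_boot all_order all_algebra.
From mathcomp Require Import reals sequences exp.
From mathcomp Require Import ring.

Set Implicit Arguments.
Unset Strict Implicit.
Unset Printing Implicit Defensive.
Import Order.TTheory GRing.Theory Num.Theory.
Local Open Scope ring_scope.

(** The quantity [sigma p m] is, up to sign, the [m]-th forward difference of
    [ln] at [p], so Pascal's rule gives [sigma_succ]: passing from [m] to
    [m + 1] replaces [sigma p m] by [sigma p m - sigma (p + 1) m].  The weights
    [2 ^- (1 + m)] halve at each step, so applying this to every term of the
    exponent of [U k.+1 p] shifts the indices down by one and gives half of
      [ln (U k p) - ln (U k (p + 1)) + (ln p - ln (p + 1)) / 2],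
    whose last summand is the contribution of index 0, absent from [U].
    Exponentiating, [U k.+1 p ^+ 2] is [U k p * L k p] ([U_succ]).

    The three other recursions follow from this one.  The one for [L] is that
    of [U] at [p + 1].  Those for [V] and [M] hold because the factor [Num.sqrt p]
    combines with [Num.sqrt (p / (p + 1))], so that the ratios
    [V k p / V k (p + 1)] and [M k p / M k (p + 1)] are exactly the radicands
    of the recursions for [U] and [L] ([V_ratio] and [M_ratio]). *)

Section Recursion.
Variable R : realType.
Implicit Types (p : R) (k m : nat).

Lemma sigma0 p : sigma p 0 = ln p.
Proof. by rewrite /sigma big_nat1 expr0 bin0 !mul1r addr0. Qed.

Lemma sigma_succ p m : sigma p m.+1 = sigma p m - sigma (p + 1) m.
Proof.
(* The terms of the difference at [p] and at [p + 1] are aligned by padding the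
   first sum with its vanishing term of index [m.+1]. *)
have pad : sigma p m =
    \sum_(0 <= j < m.+2) (-1) ^+ j * 'C(m, j)%:R * ln (p + j%:R).
  by rewrite [RHS]big_nat_recr //= bin_small // mulr0 mul0r addr0.
rewrite pad /sigma !(big_nat_recl m.+1) //= !bin0 -addrA; congr (_ + _).
rewrite -sumrB; apply: eq_bigr => j _.
rewrite binS natrD -[j.+1%:R]natr1 exprS [p + 1 + _]addrAC addrA.
ring.
Qed.

Lemma U_gt0 k p : 0 < U k p.
Proof. exact: expR_gt0. Qed.

Lemma L_gt0 k p : 0 < p -> 0 < L k p.
Proof.
move=> p0; have p1 : 0 < p + 1 by exact: addr_gt0.
by rewrite /L div1r mulr_gt0 ?sqrtr_gt0 ?divr_gt0 ?invr_gt0 ?U_gt0.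
Qed.

Lemma expR_half_ln p : 0 < p -> expR (2^-1 * ln p) = Num.sqrt p.
Proof.
move=> p0; rewrite -[LHS]ger0_norm ?expR_ge0 // -sqrtr_sqr; congr Num.sqrt.
have -> : expR (2^-1 * ln p) ^+ 2 = expR (ln p).
  by rewrite expr2 -expRD; congr expR; field.
by rewrite lnK.
Qed.

Lemma sqrt_sqr_eq (x y : R) : 0 <= x -> x ^+ 2 = y -> x = Num.sqrt y.
Proof. by move=> x0 <-; rewrite sqrtr_sqr ger0_norm. Qed.

(** Squares are compared, so that the halving in the exponent becomes an
    identity between sums of logarithms. *)
Lemma U_succ k p : 0 < p -> U k.+1 p = Num.sqrt (U k p * L k p).
Proof.
move=> p0; have p1 : 0 < p + 1 by exact: addr_gt0.
apply: sqrt_sqr_eq; first exact/ltW/U_gt0.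
rewrite /L -expR_half_ln ?divr_gt0 // div1r ln_div ?posrE // /U -expRN.
rewrite expr2 -!expRD; congr expR.
rewrite -mulr2n big_add1 /= -sumrMnl.
have halve m : 2 ^- (1 + m.+1) * sigma p m.+1 *+ 2 =
    2 ^- (1 + m) * sigma p m - 2 ^- (1 + m) * sigma (p + 1) m.
  rewrite sigma_succ addnS exprS; field.
  by rewrite expf_neq0 ?pnatr_eq0.
(* The term of index 0 is split off: it is the exponent of the square root. *)
rewrite (eq_bigr _ (fun m _ => halve m)) sumrB.
rewrite !(big_ltn (ltn0Sn k)) !sigma0 addn0 expr1.
ring.
Qed.

Lemma L_succ k p : 0 < p ->
  L k.+1 p = Num.sqrt ((p / (p + 1)) / (U k (p + 1) * L k (p + 1))).
Proof.
move=> p0; have p1 : 0 < p + 1 by exact: addr_gt0.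
rewrite {1}/L U_succ // div1r [RHS]sqrtrM ?divr_ge0 ?ltW // sqrtrV //.
by rewrite ltW // mulr_gt0 ?U_gt0 ?L_gt0.
Qed.

(** The square roots in [V] cancel exactly into the one in [L]. *)
Lemma V_ratio k p : 0 < p -> V k p / V k (p + 1) = U k p * L k p.
Proof.
move=> p0; have p1 : 0 < p + 1 by exact: addr_gt0.
rewrite /V /L sqrtrM ?ltW // sqrtrV ?ltW //; field.
by rewrite !gt_eqF ?U_gt0 ?sqrtr_gt0.
Qed.

Lemma M_sqrt k p : 0 < p -> M k p = p / Num.sqrt (p + 1) / U k (p + 1).
Proof.
move=> p0; have p1 : 0 < p + 1 by exact: addr_gt0.
rewrite /M /L sqrtrM ?ltW // sqrtrV ?ltW //.
by rewrite div1r !mulrA -expr2 sqr_sqrtr ?ltW.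
Qed.

(** Only the [L] of the numerator is expanded: it supplies [U k (p + 1)], while
    [L k (p + 1)] already stands in the denominator. *)
Lemma M_ratio k p : 0 < p ->
  M k p / M k (p + 1) = (p / (p + 1)) / (U k (p + 1) * L k (p + 1)).
Proof.
move=> p0; have p1 : 0 < p + 1 by exact: addr_gt0.
rewrite M_sqrt // /M -[X in p / X / _](sqr_sqrtr (ltW p1)); field.
by rewrite !gt_eqF ?U_gt0 ?L_gt0 ?sqrtr_gt0.
Qed.

Lemma V_succ k p : 0 < p -> V k.+1 p = Num.sqrt (p * (V k p / V k (p + 1))).
Proof. by move=> p0; rewrite V_ratio // sqrtrM ?ltW // -U_succ. Qed.

Lemma M_succ k p : 0 < p -> M k.+1 p = Num.sqrt (p * (M k p / M k (p + 1))).
Proof. by move=> p0; rewrite M_ratio // sqrtrM ?ltW // -L_succ. Qed.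

Lemma U0 p : U 0 p = 1.
Proof. by rewrite /U big_geq // expR0. Qed.

End Recursion.

Theorem proposition1p4 (R : realType) (p : R) (hp : 0 < p) :
  (forall k : nat, (1 <= k)%N ->
     [/\ U k p = Num.sqrt (U k.-1 p * L k.-1 p),
         L k p = Num.sqrt ((p / (p + 1)) / (U k.-1 (p + 1) * L k.-1 (p + 1))),
         V k p = Num.sqrt (p * (V k.-1 p / V k.-1 (p + 1)))
       & M k p = Num.sqrt (p * (M k.-1 p / M k.-1 (p + 1)))])
  /\ [/\ U 0 p = 1,
         L 0 p = Num.sqrt (p / (p + 1)),
         V 0 p = Num.sqrt p
       & M 0 p = p / Num.sqrt (p + 1)].
Proof.
split=> [[//|k] _ /=|].
  by split; [exact: U_succ | exact: L_succ | exact: V_succ | exact: M_succ].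
split; first exact: U0.
- by rewrite /L U0 divr1 mulr1.
- by rewrite /V U0 mulr1.
- by rewrite M_sqrt // U0 divr1.
Qed.
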